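(* Let $m,n\ge2$ be integers, let $\mathcal{A}$ be a real $m$th order $n$-dimensional circulant tensor with row tensors $\mathcal{A}_1,\dots,\mathcal{A}_n$, and let $P=(p_{jk})$ be the $n\times n$ permutation matrix with $p_{j,j+1}=1$ for $j\in\{1,\dots,n-1\}$, $p_{n1}=1$, and $p_{jk}=0$ otherwise. Then for every $k\in\{1,\dots,n\}$, $$\mathcal{A}_{k+1}=\mathcal{A}_kP^{m-1},$$ where $\mathcal{A}_{n+1}\equiv\mathcal{A}_1$.
   Context: Write $[n]=\{1,\dots,n\}$. A real $m$th order $n$-dimensional tensor is an array $\mathcal{A}=(a_{j_1\cdots j_m})$ of real numbers indexed by $[n]^m$. It is circulant if $a_{j_1\cdots j_m}=a_{k_1\cdots k_m}$ whenever $j_l,k_l\in[n]$ and $k_l\equiv j_l+1 \pmod n$ for all $l\in[m]$. The $k$th row tensor of $\mathcal{A}$ is the order $m-1$, dimension $n$ tensor $\mathcal{A}_k=(a^{(k)}_{j_1\cdots j_{m-1}})$ with $a^{(k)}_{j_1\cdots j_{m-1}}=a_{kj_1\cdots j_{m-1}}$. For a tensor $\mathcal{T}=(t_{j_1\cdots j_r})$ of order $r$ and dimension $n$ and an $n\times n$ matrix $Q=(q_{jk})$, $\mathcal{T}Q^r$ denotes the order $r$ tensor (not a matrix power) with entries $(\mathcal{T}Q^r)_{k_1\cdots k_r}=\sum_{j_1,\dots,j_r=1}^n t_{j_1\cdots j_r}q_{j_1k_1}\cdots q_{j_rk_r}$. *)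

(* Defs.v *)
From HB Require Import structures.
From mathcomp Require Import all_boot all_order all_algebra.
From mathcomp Require Import reals.

Set Implicit Arguments.
Unset Strict Implicit.
Unset Printing Implicit Defensive.

Import GRing.Theory.
Local Open Scope ring_scope.

(* The index set {1, ..., n} is encoded as 'I_n, the index j being represented
   by the ordinal of value j - 1. *)
Definition tensor (R : Type) (r n : nat) := {ffun r.-tuple 'I_n -> R}.

Definition circulant (R : Type) (r n : nat) (A : tensor R r n) : Prop :=
  forall J K : r.-tuple 'I_n,
    (forall l : 'I_r, tnth K l = (tnth J l).+1 %[mod n]) -> A J = A K.

Definition row_tensor (R : Type) (r n : nat) (A : tensor R r.+1 n) (k : 'I_n) :
    tensor R r n :=
  [ffun J : r.-tuple 'I_n => A [tuple of k :: J]].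

(* The tensor T Q^r, where r is the order of T. *)
Definition tensor_mulmx (R : pzSemiRingType) (r n : nat)
    (T : tensor R r n) (Q : 'M[R]_n) : tensor R r n :=
  [ffun K : r.-tuple 'I_n =>
     \sum_(J : r.-tuple 'I_n) T J * \prod_(l < r) Q (tnth J l) (tnth K l)].

(* With ordinals numbered from 0: the entry (j, j + 1) is 1 for j < n - 1, the
   entry (n - 1, 0) is 1, and every other entry is 0. *)
Definition cyclic_perm_mx (R : pzSemiRingType) (n : nat) : 'M[R]_n :=
  \matrix_(j < n, k < n)
    ((k == j.+1 :> nat) || (j.+1 == n) && (k == 0%N :> nat))%:R.

(* Main.v *)
(* The matrix P has exactly one nonzero entry in each column, so every sum in
   A_k P^(m-1) has a single nonzero term: its entry at (j_1, ..., j_(m-1)) is the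
   entry of A_k at (j_1 - 1, ..., j_(m-1) - 1). Circulance, which shifts all
   m indices at once, then absorbs these shifts into the row index. *)
Require Import Defs.
From mathcomp Require Import all_boot all_order all_algebra.
From mathcomp Require Import reals.

Import GRing.Theory.
Local Open Scope ring_scope.

Lemma cyclic_perm_mxE (R : pzSemiRingType) (n : nat) (j k : 'I_n) :
  cyclic_perm_mx R n j k = (j == ord_pred k)%:R.
Proof.
rewrite mxE -(inj_eq (@ordS_inj n)) ord_predK -val_eqE /= [RHS]/=.
congr (nat_of_bool _)%:R.
(* The residue of [j.+1] modulo [n] wraps to 0 exactly when [j.+1 = n]; then [k = j.+1] is
   impossible since [k < n]. *)
have := ltn_ord j; rewrite leq_eqVlt => /predU1P[jn|jn].
  by rewrite jn modnn eqxx /= (ltn_eqF (ltn_ord k)) eq_sym.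
by rewrite modn_small // (ltn_eqF jn) orbF eq_sym.
Qed.

Lemma tensor_mulmx_cyclic (R : pzSemiRingType) (r n : nat) (T : tensor R r n)
    (K : r.-tuple 'I_n) :
  tensor_mulmx T (cyclic_perm_mx R n) K = T [tuple of map (@ord_pred n) K].
Proof.
rewrite ffunE (bigD1 [tuple of map (@ord_pred n) K]) //= big1 => [|l _]; last first.
  by rewrite cyclic_perm_mxE tnth_map eqxx.
rewrite mulr1 big1 ?addr0 // => J /eqP neqJ.
(* A tuple other than the shifted [K] differs from it at some [l], where the matrix factor is
   zero. *)
have /existsP[l neql] : [exists l, tnth J l != ord_pred (tnth K l)].
  apply: contra_notT neqJ => /existsPn eqJ; apply: eq_from_tnth => l.
  by rewrite tnth_map; apply/eqP; rewrite -[_ == _]negbK.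
under eq_bigr do rewrite cyclic_perm_mxE.
by rewrite -natr_prod (bigD1 l) //= (negbTE neql) mul0n mulr0.
Qed.

(* The order is m = r.+1, so that the row tensors have order m - 1 = r.  The
   cyclic successor ordS k is k + 1, with n + 1 identified with 1. *)
Theorem proposition2 (R : realType) (r n : nat)
    (hm : (2 <= r.+1)%N) (hn : (2 <= n)%N)
    (A : tensor R r.+1 n) (hA : circulant A) (k : 'I_n) :
  row_tensor A (ordS k) = tensor_mulmx (row_tensor A k) (cyclic_perm_mx R n).
Proof.
apply/ffunP => K; rewrite tensor_mulmx_cyclic !ffunE.
(* Circulance leads from [k :: map ord_pred K] to [ordS k :: K]: the head advances by definition of
   [ordS], and each tail entry is the successor of its predecessor. *)
apply/esym/hA => l; case: (unliftP ord0 l) => [i|] ->; last first.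
  by rewrite !tnth0 /= modn_mod.
rewrite !tnthS tnth_map -{1}[tnth K i]ord_predK /=.
exact: modn_mod.
Qed.
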